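(* Let $G$ be a connected $\Delta$-regular graph with $n$ vertices and diameter $D$, and let $H$ be a proper subgraph of $G$. Then $$2\Delta - q(H) > \frac{1}{n\left(D-\frac{1}{4}\right)}.$$
   Context: All graphs are finite, undirected and simple. For a graph $H$, let $A(H)$ be its adjacency matrix and $D(H)$ the diagonal matrix of its vertex degrees. The signless Laplacian matrix of $H$ is $Q(H)=D(H)+A(H)$, and $q(H)$ denotes the largest eigenvalue of $Q(H)$ (the signless Laplacian spectral radius). The diameter of $G$ is the maximum distance between two vertices of $G$. A proper subgraph of $G$ is a subgraph (with at least one vertex) different from $G$. *)

(* Defs.v *)
From HB Require Import structures.
From mathcomp Require Import all_boot all_order all_algebra.
From mathcomp Require Import spectral complex polyrcf.
From mathcomp Require Import classical_sets reals.

Set Implicit Arguments.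
Unset Strict Implicit.
Unset Printing Implicit Defensive.

Import Order.TTheory GRing.Theory Num.Theory.
Local Open Scope ring_scope.

Section Graphs.
Variable T : finType.

(* A graph whose vertices are some of the elements of an ambient finite type T,
   so that a graph and its subgraphs have the same type. The well-formedness
   condition is boolean: two graphs are equal iff they have the same vertices
   and the same edges. *)
Record graph := Graph {
  verts : {set T};
  edges : {set {set T}};
  graph_wf : [forall e in edges, (e \subset verts) && (#|e| == 2)] }.

Definition adj (G : graph) : rel T := fun x y => [set x; y] \in edges G.

Definition degree (G : graph) (x : T) : nat := #|[set y | adj G x y]|.

Definition regular (G : graph) (k : nat) : Prop :=
  forall x, x \in verts G -> degree G x = k.

Definition connected (G : graph) : Prop :=
  (0 < #|verts G|)%N /\
  forall x y, x \in verts G -> y \in verts G -> connect (adj G) x y.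

Definition walk_of_length (G : graph) (x y : T) (k : nat) : bool :=
  [exists p : k.-tuple T, path (adj G) x p && (last x p == y)].

(* Least length of a walk from x to y. A shortest walk has fewer than #|T|
   edges; the value is #|T| if y cannot be reached from x. *)
Definition dist (G : graph) (x y : T) : nat :=
  find (walk_of_length G x y) (iota 0 #|T|).

Definition diameter (G : graph) : nat :=
  \max_(x in verts G) \max_(y in verts G) dist G x y.

Definition proper_subgraph (H G : graph) : Prop :=
  [/\ (0 < #|verts H|)%N, verts H \subset verts G, edges H \subset edges G
    & H <> G].

(* Matrices indexed by the vertices of G, enumerated by enum_val. *)
Definition adjacency_mx (R : nzRingType) (G : graph) : 'M[R]_#|verts G| :=
  \matrix_(i, j) (adj G (enum_val i) (enum_val j))%:R.

Definition degree_mx (R : nzRingType) (G : graph) : 'M[R]_#|verts G| :=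
  diag_mx (\row_i (degree G (enum_val i))%:R).

Definition signless_laplacian (R : nzRingType) (G : graph) :
    'M[R]_#|verts G| :=
  degree_mx R G + adjacency_mx R G.

(* The supremum is a maximum as soon as G has a vertex: see
   signless_radius_max below. *)
Definition signless_radius (R : realType) (G : graph) : R :=
  sup [set a : R | eigenvalue (signless_laplacian R G) a]%classic.

End Graphs.

Lemma symmetric_eigenvalue (R : rcfType) n (A : 'M[R]_n) :
  (0 < n)%N -> A^T = A -> exists a, eigenvalue A a.
Proof.
move=> n_gt0 symA; pose f : {rmorphism R -> R[i]} := real_complex R.
have [a] : exists a, eigenvalue (map_mx f A) a by apply: eigenvalue_closed.
move=> ea; suff: a \is Num.real.
  case/complex_realP => b eb; exists b.
  by rewrite -(eigenvalue_map f) -[f b]eb.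
have/eigenvalueP[v vA v0] := ea.
pose w := map_mx Num.conj v.
have conjA : map_mx Num.conj (map_mx f A) = map_mx f A.
  by apply/matrixP=> i j; rewrite !mxE; apply/CrealP/complex_realP; exists (A i j).
have wA : w *m map_mx f A = Num.conj a *: w.
  by rewrite -{1}conjA -map_mxM vA map_mxZ.
have eq1 : v *m map_mx f A *m w^T = v *m (w *m map_mx f A)^T.
  by rewrite trmx_mul [(map_mx f A)^T]map_trmx symA mulmxA.
have : (a - Num.conj a) *: (v *m w^T) = 0.
  by rewrite scalerBl scalemxAl -vA eq1 wA linearZ /= -scalemxAr subrr.
move/matrixP/(_ 0 0); rewrite !mxE => /eqP; rewrite mulf_eq0 => /orP[|].
  by rewrite subr_eq0 eq_sym => /eqP/CrealP.
rewrite psumr_eq0 => [/allP z|i _]; last by rewrite !mxE mul_conjC_ge0.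
case/eqP: v0; apply/rowP=> i.
have /= := z i (mem_index_enum i); rewrite !mxE mul_conjC_eq0.
by move/eqP.
Qed.

Lemma signless_radius_max (R : realType) (T : finType) (G : graph T) :
  (0 < #|verts G|)%N ->
  eigenvalue (signless_laplacian R G) (signless_radius R G) /\
  forall a, eigenvalue (signless_laplacian R G) a -> a <= signless_radius R G.
Proof.
move=> n_gt0; rewrite /signless_radius.
set Q := signless_laplacian R G.
have [|b eb] := @symmetric_eigenvalue R _ Q n_gt0.
  rewrite /Q /signless_laplacian linearD /= tr_diag_mx; congr (_ + _).
  by apply/matrixP=> i j; rewrite !mxE /adj finset.setUC.
pose s := rootsR (char_poly Q).
have sE a : (a \in s) = eigenvalue Q a.
  have p0 : char_poly Q != 0 by rewrite monic_neq0 ?char_poly_monic.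
  by rewrite -roots_on_rootsR // in_itv eigenvalue_root_char.
pose m := \big[Num.max/b]_(x <- s) x.
have em : eigenvalue Q m.
  rewrite /m big_seq; apply: (big_ind (eigenvalue Q)) => // [x y ex ey|x].
    by case: (leP x y).
  by rewrite sE.
have ubm a : eigenvalue Q a -> a <= m by rewrite -sE => sa; apply: le_bigmax_seq.
have -> : sup [set a : R | eigenvalue Q a]%classic = m; last by [].
apply/le_anti/andP; split; first by apply: ge_sup => //; exists b.
by apply: ub_le_sup => //; exists m.
Qed.

(* Main.v *)
Require Import Defs.
From mathcomp Require Import all_boot all_order all_algebra.
From mathcomp Require Import reals.
From mathcomp Require Import ring lra zify.

Set Implicit Arguments.
Unset Strict Implicit.
Unset Printing Implicit Defensive.

(** Let [x] be an eigenvector of the signless Laplacian of [H] for its largest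
    eigenvalue [q], extended by zero to all vertices, and let [uv] be an edge
    of [G] that [H] misses.  Since [G] is [Delta]-regular,
    [2 Delta sum x_a^2 = sum (x_a + x_b)^2 + sum (x_a - x_b)^2] over the edges
    [ab] of [G], whereas [q sum x_a^2] is the first sum taken over the edges of
    [H] only.  Hence [(2 Delta - q) sum x_a^2] is at least
    [K = sum (x_a - x_b)^2 + (x_u + x_v)^2]
    ([signless_radius_quadratic_form], [spectral_gap_ge_energy]).

    The edge [uv] and the last term together contribute
    [(x_u - x_v)^2 + (x_u + x_v)^2 = 2 x_u^2 + 2 x_v^2] to [K].  So [K] is the energy of the potential [x] in
    the electrical network made of the other edges of [G], with unit
    resistances, in which [u] and [v] are moreover grounded through resistances
    [1/2].  If the effective resistance from a vertex [w] to the ground is at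
    most [r], then [x_w^2 <= r K].  A geodesic from [w] to the nearer of [u] and
    [v] does not use [uv]; when its length is less than the diameter [D], it
    gives [r = D - 1 + 1/2].  Otherwise [u] and [v] are both at distance [D]
    from [w], and sending half of a unit current along a geodesic to each of
    them gives [r = (D - 1) + 1/2 + 1/4 = D - 1/4]: the first [D - 1] layers
    cost at most [1] each, but the two last edges are distinct since [u <> v],
    so they and the two grounding resistances work in parallel
    ([sqr_vertex_le_energy]).

    Take [w] with [x_w^2] maximal, so that [sum x_a^2 <= n x_w^2
    <= n (D - 1/4) K], which is the theorem with a weak inequality.  The first
    step is strict unless [x_u^2 = x_v^2 = x_w^2]; in that case
    [K >= 2 x_u^2 + 2 x_v^2 = 4 x_w^2] is more than enough. *)

Import Order.TTheory GRing.Theory Num.Theory.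
Local Open Scope ring_scope.

(** * Walks, geodesics and subgraphs *)

Section GraphFacts.
Context {T : finType}.
Implicit Types (G H : graph T) (x y a b : T).

Lemma adj_sym G a b : adj G a b = adj G b a.
Proof. by rewrite /adj setUC. Qed.

Lemma adj_wf G a b : adj G a b -> [/\ a \in verts G, b \in verts G & a != b].
Proof.
move=> ab; have /forallP/(_ [set a; b])/implyP/(_ ab)/andP[] := graph_wf G.
rewrite cards2 subUset !sub1set => /andP[-> ->].
by case: (a =P b).
Qed.

Lemma walkP G x y k :
  reflect (exists p, [/\ path (adj G) x p, size p = k & last x p = y])
          (walk_of_length G x y k).
Proof.
apply: (iffP existsP) => [[p /andP[xp /eqP py]]|[p [xp pk py]]].
  by exists p; rewrite size_tuple.
by move/eqP: pk => pk; exists (Tuple pk); rewrite /= xp py eqxx.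
Qed.

Lemma dist_le_walk G x y k : walk_of_length G x y k -> (dist G x y <= k)%N.
Proof.
move=> wk; rewrite leqNgt; apply/negP => lt_k.
have := before_find 0%N lt_k; rewrite nth_iota ?wk //.
by apply: leq_trans lt_k _; rewrite -[X in (_ <= X)%N](size_iota 0) find_size.
Qed.

Lemma walk_dist G x y :
  (dist G x y < #|T|)%N -> walk_of_length G x y (dist G x y).
Proof.
move=> lt_T; have wk : has (walk_of_length G x y) (iota 0 #|T|).
  by rewrite has_find size_iota.
by have := nth_find 0%N wk; rewrite nth_iota.
Qed.

Lemma dist_lt_card G x y : connect (adj G) x y -> (dist G x y < #|T|)%N.
Proof.
case/connectP => p xp ->; case/shortenP: xp => p' xp' up' _.
apply: (@leq_ltn_trans (size p')); first by apply: dist_le_walk; apply/walkP; exists p'.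
by rewrite -[_.+1]/(size (x :: p')) -(card_uniqP up') max_card.
Qed.

(** A shortest walk, as a function of the number of steps: its [i]-th vertex
    lies at distance exactly [i] from the origin, because a shorter way to that
    vertex would shorten the whole walk. *)
Lemma geodesic G x y : connect (adj G) x y ->
  exists f : nat -> T, [/\ f 0%N = x, f (dist G x y) = y,
    forall i, (i < dist G x y)%N -> adj G (f i) (f i.+1) &
    forall i, (i <= dist G x y)%N -> dist G x (f i) = i].
Proof.
move=> /dist_lt_card lt_T; have /walkP[p [xp sp py]] := walk_dist lt_T.
have fE i : (i <= size p)%N -> nth x (x :: p) i = last x (take i p).
  move=> ip; rewrite (last_nth x) size_takel //.
  by rewrite -[x :: take i p]/(take i.+1 (x :: p)) nth_take.
exists (nth x (x :: p)); split => // [|i|i].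
- by rewrite -sp -last_nth.
- by rewrite -sp; move/pathP: xp; apply.
rewrite -sp => ip; have := xp; rewrite -{1}(cat_take_drop i p) cat_path -fE //.
case/andP => xpi pi_y.
have le_i : (dist G x (nth x (x :: p) i) <= i)%N.
  by apply: dist_le_walk; apply/walkP; exists (take i p); rewrite size_takel ?fE.
have [q [xq sq qi]] : exists q, [/\ path (adj G) x q,
    size q = dist G x (nth x (x :: p) i) & last x q = nth x (x :: p) i].
  apply/walkP/walk_dist; apply: leq_ltn_trans lt_T.
  by rewrite -sp (leq_trans le_i).
apply/eqP; rewrite eqn_leq le_i -sq /= -(leq_add2r (size p - i)) subnKC //.
rewrite {1}sp -size_drop -size_cat; apply: dist_le_walk; apply/walkP.
exists (q ++ drop i p); rewrite cat_path xq qi pi_y; split=> //.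
by rewrite last_cat qi fE // -last_cat cat_take_drop.
Qed.

Lemma dist_gt0 G x y :
  connect (adj G) x y -> x != y -> (0 < dist G x y)%N.
Proof.
case/geodesic => f [f0 fd _ _]; rewrite lt0n.
by apply: contraNneq => d0; rewrite -f0 -fd d0.
Qed.

Lemma dist_le_diameter G x y :
  x \in verts G -> y \in verts G -> (dist G x y <= diameter G)%N.
Proof.
move=> xG yG; apply: leq_trans (leq_bigmax_cond _ xG).
exact: (leq_bigmax_cond (F := fun y => dist G x y) _ yG).
Qed.

(** If only vertices were missing, a path in [G] from a missing vertex to one of
    [H] would begin with an edge of [H] at the missing vertex. *)
Lemma proper_subgraph_missing_edge G H : connected G -> proper_subgraph H G ->
  exists u v, adj G u v /\ ~~ adj H u v.
Proof.
move=> [_ Gc] [/card_gt0P[b bH] vHG eHG neq].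
have [/eqP eq_e|] := boolP (edges H == edges G); last first.
  rewrite eqEsubset eHG /= => /subsetPn[e eG eH].
  have /forallP/(_ e)/implyP/(_ eG)/andP[_ /cards2P[u [v [_ e_uv]]]] := graph_wf G.
  by exists u, v; rewrite /adj -e_uv.
have [/eqP eq_v|] := boolP (verts H == verts G).
  case: neq; case: H G eq_e eq_v {Gc vHG eHG bH} => [V E wf] [V' E' wf'] /= EE VV.
  by move: wf wf'; rewrite EE VV => wf wf'; rewrite (bool_irrelevance wf wf').
rewrite eqEsubset vHG /= => /subsetPn[a aG aH].
have /connectP[[|c p] /= ap abp] := Gc _ _ aG (subsetP vHG _ bH).
  by rewrite -abp bH in aH.
have /andP[ac _] := ap; have : adj H a c by rewrite /adj eq_e.
by case/adj_wf => aH'; rewrite aH' in aH.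
Qed.

End GraphFacts.

(** * Quadratic forms and energy *)

Section Energy.
Context {R : realType} {T : finType}.
Implicit Types (G H : graph T) (x : T -> R).

(** Sums over edges are written as sums over ordered pairs of adjacent vertices,
    so every edge is counted twice. *)
Lemma degree_sum G (F : T -> R) :
  \sum_a (degree G a)%:R * F a = \sum_(p : T * T | adj G p.1 p.2) F p.1.
Proof.
rewrite -(pair_big_dep predT (adj G) (fun a _ => F a)) /=; apply: eq_bigr => a _.
by rewrite sumr_const mulr_natl /degree cardsE.
Qed.

Lemma sum_adj_swap G (F : T -> T -> R) :
  \sum_(p : T * T | adj G p.1 p.2) F p.1 p.2 =
  \sum_(p : T * T | adj G p.1 p.2) F p.2 p.1.
Proof.
rewrite (reindex_inj (h := fun p : T * T => (p.2, p.1))) /=; last first.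
  by apply: (can_inj (g := fun p : T * T => (p.2, p.1))) => -[].
by apply: eq_bigl => p; rewrite adj_sym.
Qed.

(** The factor [2] on the left accounts for the two orientations of each edge
    on the right. *)
Lemma signless_radius_quadratic_form H : (0 < #|verts H|)%N ->
  exists x, [/\ forall a, a \notin verts H -> x a = 0, 0 < \sum_a x a ^+ 2 &
    2 * signless_radius R H * \sum_a x a ^+ 2 =
      \sum_(p : T * T | adj H p.1 p.2) (x p.1 + x p.2) ^+ 2].
Proof.
case/(signless_radius_max R) => /eigenvalueP[v vQ v0] _.
set q := signless_radius R H in vQ *.
pose x a := \sum_(i < #|verts H| | enum_val i == a) v 0 i.
have x_out a : a \notin verts H -> x a = 0.
  by move=> aH; apply: big1 => i /eqP ia; rewrite -ia enum_valP in aH.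
have xE i : x (enum_val i) = v 0 i.
  by rewrite /x (eq_bigl (pred1 i)) ?big_pred1_eq // => j /=;
    rewrite (inj_eq enum_val_inj).
have sumE (F : T -> R) : (forall a, a \notin verts H -> F a = 0) ->
    \sum_a F a = \sum_(i < #|verts H|) F (enum_val i).
  move=> F0; rewrite -big_enum_val [RHS]big_mkcond /=.
  by apply: eq_bigr => a _; case: ifPn => // /F0.
have vQi (i : 'I_#|verts H|) : q * x (enum_val i) = (degree H (enum_val i))%:R * x (enum_val i) +
    \sum_b (adj H (enum_val i) b)%:R * x b.
  have /rowP/(_ i) := vQ; rewrite !mxE -xE => <-.
  rewrite sumE; last by move=> b bH; rewrite x_out ?mulr0.
  (* Separate the diagonal term of the i-th column of the matrix. *)
  rewrite (eq_bigr (fun j => (degree H (enum_val i))%:R * x (enum_val i) *+ (j == i)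
     + (adj H (enum_val i) (enum_val j))%:R * x (enum_val j))); last first.
    move=> j _; rewrite !mxE -xE mulrDr adj_sym; congr (_ + _); last exact: mulrC.
    by case: eqP => [->|]; rewrite ?mulr1n ?mulr0n ?mulr0 // mulrC.
  rewrite big_split /= (bigD1 i) //= eqxx big1 ?addr0 // => j /negbTE ->.
  by rewrite mulr0n.
exists x; split => //.
  rewrite lt_def sumr_ge0 ?andbT => [|a _]; last exact: sqr_ge0.
  apply: contraNneq v0 => /psumr_eq0P x0; apply/eqP/rowP => i.
  by apply/eqP; rewrite mxE -xE -sqrf_eq0 x0 // => a _; exact: sqr_ge0.
have qx a : q * x a ^+ 2 = (degree H a)%:R * x a ^+ 2 +
    \sum_(b | adj H a b) x a * x b.
  have [aH|aH] := boolP (a \in verts H); last first.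
    rewrite x_out // expr0n /= !mulr0 add0r big1 // => b _.
    by rewrite mul0r.
  rewrite -[in LHS](enum_rankK_in aH aH) expr2 mulrA vQi enum_rankK_in //.
  rewrite mulrDl -mulrA; congr (_ + _); rewrite mulr_suml [RHS]big_mkcond /=.
  by apply: eq_bigr => b _; case: ifP; rewrite ?mul1r ?mul0r // mulrC.
rewrite -mulrA mulr_sumr (eq_bigr _ (fun a _ => qx a)) big_split /= degree_sum.
rewrite pair_big_dep /= [RHS](eq_bigr (fun p => x p.1 ^+ 2 + x p.2 ^+ 2 +
  2 * (x p.1 * x p.2))) => [|p _]; last by ring.
rewrite big_split big_split /= -mulr_sumr.
rewrite -(sum_adj_swap H (fun a _ => x a ^+ 2)); ring.
Qed.

(** By regularity the first term on the right is the sum of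
    [(x_a + x_b)^2 + (x_a - x_b)^2] over the adjacent pairs of [G]; the pairs
    adjacent in [H] cancel the plus part, except at [(u, v)] and [(v, u)]. *)
Lemma spectral_gap_ge_energy G H x Delta u v : regular G Delta ->
  edges H \subset edges G -> adj G u v -> ~~ adj H u v ->
  (forall a, a \notin verts G -> x a = 0) ->
  \sum_(p : T * T | adj G p.1 p.2) (x p.1 - x p.2) ^+ 2 + 2 * (x u + x v) ^+ 2
  <= 4 * Delta%:R * (\sum_a x a ^+ 2) -
     \sum_(p : T * T | adj H p.1 p.2) (x p.1 + x p.2) ^+ 2.
Proof.
move=> Greg eHG uvG uvH x0.
have DE : 4 * Delta%:R * (\sum_a x a ^+ 2) =
    \sum_(p : T * T | adj G p.1 p.2) (x p.1 + x p.2) ^+ 2 +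
    \sum_(p : T * T | adj G p.1 p.2) (x p.1 - x p.2) ^+ 2.
  have -> : 4 * Delta%:R * (\sum_a x a ^+ 2) =
      4 * \sum_a (degree G a)%:R * x a ^+ 2.
    rewrite -mulrA; congr (_ * _); rewrite mulr_sumr; apply: eq_bigr => a _.
    have [/Greg -> //|/x0 ->] := boolP (a \in verts G).
    by rewrite expr0n /= !mulr0.
  rewrite degree_sum -big_split /=.
  rewrite [RHS](eq_bigr (fun p => 2 * x p.1 ^+ 2 + 2 * x p.2 ^+ 2)) => [|p _]; last by ring.
  rewrite big_split /= -!mulr_sumr -(sum_adj_swap G (fun a _ => x a ^+ 2)); ring.
have HG (p : T * T) : adj H p.1 p.2 -> adj G p.1 p.2 by exact: (subsetP eHG).
have split_H : \sum_(p : T * T | adj G p.1 p.2) (x p.1 + x p.2) ^+ 2 =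
    \sum_(p : T * T | adj H p.1 p.2) (x p.1 + x p.2) ^+ 2 +
    \sum_(p : T * T | adj G p.1 p.2 && ~~ adj H p.1 p.2) (x p.1 + x p.2) ^+ 2.
  rewrite (bigID (fun p => adj H p.1 p.2)) /=; congr (_ + _).
  by apply: eq_bigl => p; apply/andP/idP => [[]//|h]; split=> //; exact: HG.
rewrite DE split_H.
have uv : u != v by have [] := adj_wf uvG.
have : 2 * (x u + x v) ^+ 2 <= \sum_(p : T * T | adj G p.1 p.2 && ~~ adj H p.1 p.2)
   (x p.1 + x p.2) ^+ 2; last by lra.
rewrite (bigD1 (u, v)) /= ?uvG // (bigD1 (v, u)) /=; last first.
  by rewrite !(adj_sym _ v) uvG uvH /= xpair_eqE eq_sym negb_and uv.
rewrite addrA -[X in X <= _]addr0 lerD //; first by lra.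
by apply: sumr_ge0 => p _; exact: sqr_ge0.
Qed.

(** Whatever the level function [h], an edge climbs from level [i] to level
    [i.+1] for at most one [i], and in one direction only; the edge [uv] lies at
    height [k] or above and so is none of the edges that climb from a level
    below [k]. *)
Lemma energy_ge_levels G x (h : T -> nat) k u v : adj G u v ->
  (k <= h u)%N -> (k <= h v)%N ->
  2 * (\sum_(i < k) \sum_(p : T * T | [&& adj G p.1 p.2, h p.1 == i & h p.2 == i.+1])
         (x p.1 - x p.2) ^+ 2 + (x u - x v) ^+ 2)
  <= \sum_(p : T * T | adj G p.1 p.2) (x p.1 - x p.2) ^+ 2.
Proof.
move=> uvG ku kv; have [_ _ uv] := adj_wf uvG.
pose F (p : T * T) : R := (x p.1 - x p.2) ^+ 2.
have F_ge0 p : 0 <= F p by exact: sqr_ge0.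
pose lev (p : T * T) := [&& adj G p.1 p.2, (h p.1 < k)%N & h p.2 == (h p.1).+1].
pose up (p : T * T) := lev p || (p == (u, v)).
have upF : \sum_(i < k) \sum_(p : T * T | [&& adj G p.1 p.2, h p.1 == i & h p.2 == i.+1])
         F p + F (u, v) = \sum_(p | up p) F p.
  rewrite [RHS](bigD1 (u, v)) /= ?/up ?eqxx ?orbT // addrC; congr (_ + _).
  rewrite [RHS](eq_bigl lev) => [|p]; last first.
    case: (p =P (u, v)) => [->|]; rewrite ?andbF ?orbF ?andbT //.
    by rewrite /lev /= ltnNge ku andbF.
  rewrite (exchange_big_dep lev) /= => [|i p _ /and3P[pG /eqP hi /eqP hj]]; last first.
    by rewrite /lev pG hi hj ltn_ord eqxx.
  apply: eq_bigr => p /and3P[pG hk /eqP hp].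
  rewrite (bigD1 (Ordinal hk)) /=; last by rewrite pG hp !eqxx.
  rewrite big1 ?addr0 // => i /andP[/and3P[_ /eqP hi _]].
  by rewrite -val_eqE /= hi eqxx.
have split_up : \sum_(p : T * T | adj G p.1 p.2) F p =
    \sum_(p | up p) F p + \sum_(p : T * T | adj G p.1 p.2 && ~~ up p) F p.
  rewrite (bigID up) /=; congr (_ + _); apply: eq_bigl => p.
  by apply/andP/idP => [[]//|p_up]; split=> //; case/orP: p_up => [/and3P[]//|/eqP->].
rewrite -[(x u - x v) ^+ 2]/(F (u, v)) upF split_up mulrDl mul1r lerD2l.
(* The selected orientations of edges are disjoint from their reversals. *)
rewrite (reindex_inj (h := fun p : T * T => (p.2, p.1))) /=; last first.
  by apply: (can_inj (g := fun p : T * T => (p.2, p.1))) => -[].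
rewrite (eq_bigr F) => [|p _]; last by rewrite /F /=; ring.
rewrite [leLHS]big_mkcond [leRHS]big_mkcond; apply: ler_sum => -[a b] _ /=.
case: ifPn => [|_]; last by case: ifP.
rewrite /up /lev !xpair_eqE /= => p_up.
suff -> : adj G a b && ~~ [|| [&& adj G a b, (h a < k)%N & h b == (h a).+1]
   | (a == u) && (b == v)] by [].
case/orP: p_up => [/and3P[ba hb /eqP ha]|/andP[/eqP bu /eqP av]].
  rewrite adj_sym ba ha /= negb_or; apply/andP; split.
    by rewrite negb_and; apply/orP; right; lia.
  by apply/negP => /andP[_ /eqP bv]; move: hb; rewrite bv ltnNge kv.
rewrite bu av adj_sym uvG [(h v < k)%N]ltnNge kv /=.
by rewrite eq_sym (negbTE uv).
Qed.

End Energy.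

(** * Effective resistance *)

(** Unit resistors between the points [0], ..., [k] of a line, and a device at
    [k] that dissipates [c] and behaves like a resistance [r] to the ground:
    the resistances add up. *)
Lemma series_resistance (F : realFieldType) (m : nat -> F) (c r : F) k : 0 < r ->
  m k ^+ 2 <= r * c ->
  m 0%N ^+ 2 <= (k%:R + r) * (\sum_(i < k) (m i - m i.+1) ^+ 2 + c).
Proof.
elim: k m c r => [|k IH] m c r r0 mc; first by rewrite big_ord0 !add0r.
have H : m k ^+ 2 <= (r + 1) * ((m k - m k.+1) ^+ 2 + c).
  have c0 : 0 <= c by rewrite -(pmulr_rge0 _ r0); apply: le_trans mc; exact: sqr_ge0.
  set d := m k - m k.+1; have -> : m k = d + m k.+1 by rewrite /d; ring.
  rewrite -(ler_pM2l r0).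
  have := sqr_ge0 (r * d - m k.+1).
  nra.
have {IH} := IH m _ _ _ H; rewrite big_ord_recr /= -addrA.
by rewrite -natr1 -!addrA (addrC 1) => /(_ _); apply; lra.
Qed.

(** The effective resistance between [w] and the ground is at most [D - 1/4],
    where [D] is the diameter.  The levels are the distances to [w], and the
    current flows along geodesics from [w], one edge per level.  The sum over
    ordered pairs is halved so as to count each edge once. *)
Lemma sqr_vertex_le_energy (R : realType) (T : finType) (G : graph T) (x : T -> R)
    u v w : connected G -> adj G u v -> w \in verts G ->
  x w ^+ 2 <= ((diameter G)%:R - 1 / 4) *
    (\sum_(p : T * T | adj G p.1 p.2) (x p.1 - x p.2) ^+ 2 / 2 + (x u + x v) ^+ 2).
Proof.
move=> [_ Gc]; wlog uv_le : u v / (dist G w u <= dist G w v)%N => [IH uvG wG|uvG wG].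
  have [/IH|/ltnW/IH] := leqP (dist G w u) (dist G w v); first exact.
  by rewrite [x v + _]addrC adj_sym; exact.
have [uG vG uv] := adj_wf uvG.
have uD := dist_le_diameter wG uG; have vD := dist_le_diameter wG vG.
pose L i := \sum_(p : T * T | [&& adj G p.1 p.2, dist G w p.1 == i & dist G w p.2 == i.+1])
   (x p.1 - x p.2) ^+ 2.
have L_ge1 i a b : adj G a b -> dist G w a = i -> dist G w b = i.+1 ->
    (x a - x b) ^+ 2 <= L i.
  move=> ab ai bi; rewrite /L (bigD1 (a, b)) /=; last by rewrite ab ai bi !eqxx.
  by rewrite lerDl sumr_ge0 // => p _; exact: sqr_ge0.
rewrite -mulr_suml; set E := \sum_(p | _) _.
have two_E : 2 * (\sum_(i < dist G w u) L i + (x u - x v) ^+ 2) <= E.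
  exact: energy_ge_levels (leqnn _) uv_le.
have {two_E}E_ge : \sum_(i < dist G w u) L i + 2 * x u ^+ 2 + 2 * x v ^+ 2 <=
    E / 2 + (x u + x v) ^+ 2 by lra.
have [f [f0 fu fadj flev]] := geodesic (Gc _ _ wG uG).
have [g [g0 gv gadj glev]] := geodesic (Gc _ _ wG vG).
have [u_near|u_far] := ltnP (dist G w u) (diameter G).
  have le_sum : \sum_(i < dist G w u) (x (f i) - x (f i.+1)) ^+ 2 <=
      \sum_(i < dist G w u) L i.
    apply: ler_sum => i _; have ltiu := ltn_ord i.
    by apply: L_ge1; rewrite ?fadj ?flev // ltnW.
  (* A single geodesic to u, then the resistance 1/2 from u to the ground. *)
  have half_gt0 : 0 < 1 / 2 :> R by lra.
  have xu : (x \o f) (dist G w u) ^+ 2 <= 1 / 2 * (2 * x u ^+ 2).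
    by rewrite /= fu; lra.
  have := series_resistance half_gt0 xu; rewrite /= f0 => /le_trans; apply.
  have kD : (dist G w u)%:R + 1 <= (diameter G)%:R :> R by rewrite natr1 ler_nat.
  have u2 := sqr_ge0 (x u); have v2 := sqr_ge0 (x v).
  apply: ler_pM; [by rewrite addr_ge0 ?ler0n //; lra| |lra|lra].
  by apply: addr_ge0; [apply: sumr_ge0 => i _; exact: sqr_ge0|lra].
have uE : dist G w u = diameter G by apply/eqP; rewrite eqn_leq uD.
have vE : dist G w v = diameter G by apply/eqP; rewrite eqn_leq vD -uE.
rewrite uE in E_ge fu fadj flev; rewrite vE in gv gadj glev.
have D_gt0 : (0 < diameter G)%N := leq_trans (dist_gt0 (Gc _ _ uG vG) uv) (dist_le_diameter uG vG).
case: (diameter G) D_gt0 E_ge fu fadj flev gv gadj glev => // k _ E_ge fu fadj flev gv gadj glev.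
(* The mean of the two geodesics is a path of potentials whose steps cost no
   more than the level they cross, even where the geodesics share an edge. *)
pose m i := (x (f i) + x (g i)) / 2.
have le_sum : \sum_(i < k) (m i - m i.+1) ^+ 2 <= \sum_(i < k) L i.
  apply: ler_sum => i _; have ltik := ltn_ord i.
  have Lf : (x (f i) - x (f i.+1)) ^+ 2 <= L i.
    by apply: L_ge1; rewrite ?fadj ?flev // ltnW // ltnW.
  have Lg : (x (g i) - x (g i.+1)) ^+ 2 <= L i.
    by apply: L_ge1; rewrite ?gadj ?glev // ltnW // ltnW.
  have := sqr_ge0 ((x (f i) - x (f i.+1)) - (x (g i) - x (g i.+1))).
  rewrite /m; nra.
have L_last : (x (f k) - x u) ^+ 2 + (x (g k) - x v) ^+ 2 <= L k.
  rewrite -fu -gv /L (bigD1 (f k, f k.+1)) /=; last first.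
    by rewrite fadj ?flev ?eqxx.
  rewrite lerD2l (bigD1 (g k, g k.+1)) /=; last first.
    rewrite gadj ?glev ?eqxx //= xpair_eqE negb_and fu gv [v == u]eq_sym uv.
    by rewrite orbT.
  by rewrite lerDl sumr_ge0 // => p _; exact: sqr_ge0.
rewrite big_ord_recr /= in E_ge.
(* At the last level, two branches of resistance 1 + 1/2 are in parallel: 3/4.
   The minimum over x u of (x (f k) - x u)^2 + 2 (x u)^2 is at 3 x u = x (f k). *)
have mk : m k ^+ 2 <= 3 / 4 * (L k + 2 * x u ^+ 2 + 2 * x v ^+ 2).
  have := sqr_ge0 (x (f k) - 3 * x u); have := sqr_ge0 (x (g k) - 3 * x v).
  have := sqr_ge0 (x (f k) - x (g k)).
  rewrite /m; nra.
have r_gt0 : 0 < 3 / 4 :> R by lra.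
have m0 : m 0%N = x w by rewrite /m f0 g0; field.
have := series_resistance r_gt0 mk; rewrite m0 => /le_trans; apply.
have -> : k.+1%:R - 1 / 4 = k%:R + 3 / 4 :> R by rewrite -natr1; field.
by rewrite ler_pM2l ?ltr_wpDl ?ler0n //; lra.
Qed.

Theorem theorem1p1 (R : realType) (T : finType) (G H : graph T)
    (Delta n D : nat) (Gconn : connected G) (Greg : regular G Delta)
    (Gn : #|verts G| = n) (GD : diameter G = D) (HG : proper_subgraph H G) :
  2 * Delta%:R - signless_radius R H > 1 / (n%:R * (D%:R - 1 / 4)).
Proof.
have [_ Gc] := Gconn; have [H_gt0 vHG eHG _] := HG.
have [u [v [uvG uvH]]] := proper_subgraph_missing_edge Gconn HG.
have [uG vG uv] := adj_wf uvG.
have [x [x_out X_gt0 qX]] := @signless_radius_quadratic_form R T H H_gt0.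
have x0 a : a \notin verts G -> x a = 0.
  by move=> aG; apply: x_out; apply: contra aG; exact: (subsetP vHG).
have := spectral_gap_ge_energy Greg eHG uvG uvH x0; rewrite -qX.
pose w := [arg max_(a > u) x a ^+ 2]%O.
have w_max a : x a ^+ 2 <= x w ^+ 2 by rewrite /w; case: arg_maxP => // b _; exact.
have w2_gt0 : 0 < x w ^+ 2.
  rewrite ltNge; apply/negP => w_le0; move: X_gt0; rewrite ltNge => /negP[].
  by apply: sumr_le0 => a _; apply: le_trans w_le0.
have wG : w \in verts G.
  by apply: contraLR w2_gt0 => /x0 ->; rewrite expr0n /= ltxx.
have := energy_ge_levels x uvG (leq0n (dist G w u)) (leq0n _).
have := sqr_vertex_le_energy x Gconn uvG wG.
rewrite big_ord0 add0r -mulr_suml GD.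
set E := \sum_(p | _) _; set q := signless_radius R H in qX *.
set X := \sum_a _ in X_gt0 qX *; set K := E / 2 + _ => wK uvE gap.
have D_ge1 : 1 <= D%:R :> R.
  rewrite ler1n -GD.
  exact: leq_trans (dist_gt0 (Gc _ _ uG vG) uv) (dist_le_diameter uG vG).
have n_gt0 : 0 < n%:R :> R by rewrite ltr0n -Gn; apply/card_gt0P; exists u.
(* The zero extension makes X a sum over the n vertices of G. *)
have XE : X = \sum_(a in verts G) x a ^+ 2.
  rewrite [RHS]big_mkcond; apply: eq_bigr => a _; case: ifPn => // /x0 ->.
  by rewrite expr0n.
have nE : n%:R * x w ^+ 2 = \sum_(a in verts G) x w ^+ 2.
  by rewrite sumr_const Gn mulr_natl.
have X_le : X <= n%:R * x w ^+ 2 by rewrite XE nE; apply: ler_sum.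
have Kgap : K <= (2 * Delta%:R - q) * X by rewrite /K; lra.
have X_lt : X < n%:R * ((D%:R - 1 / 4) * K).
  have [/andP[/eqP uw /eqP vw]|] := boolP ((x u ^+ 2 == x w ^+ 2) && (x v ^+ 2 == x w ^+ 2)).
    apply: le_lt_trans X_le _; rewrite ltr_pM2l //.
    have : 4 * x w ^+ 2 <= K by rewrite /K; lra.
    nra.
  (* Here u or v makes the sum of squares strictly less than n times the maximum. *)
  move=> not_flat; apply: (@lt_le_trans _ _ (n%:R * x w ^+ 2)); last by rewrite ler_pM2l.
  have [a aG a_lt] : exists2 a, a \in verts G & x a ^+ 2 < x w ^+ 2.
    by case/nandP: not_flat => ne; [exists u|exists v] => //; rewrite lt_def eq_sym ne w_max.
  rewrite XE nE (bigD1 a) //= [ltRHS](bigD1 a) //=.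
  by apply: ltr_leD => //; apply: ler_sum.
have den_gt0 : 0 < n%:R * (D%:R - 1 / 4) :> R by rewrite mulr_gt0 //; lra.
rewrite ltr_pdivrMr // -(ltr_pM2r X_gt0) [ltLHS]mul1r mulrAC [ltRHS]mulrC.
by apply: lt_le_trans X_lt _; rewrite mulrA ler_pM2l.
Qed.
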